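(* In the setting of the context, suppose the regularity assumption and the local worst-case oracle assumption hold, and fix $x\in\mathcal X$ (write $\ell_k(z)=\ell_k(x,z)$). Consider the budget allocation problem $\max\{\frac1N\sum_{i=1}^NV_i(b_i):b\in\mathbb R_+^N,\ \frac1N\sum_{i=1}^Nb_i\le\rho\}$. There exists an optimal dual multiplier $\lambda^\star$ of its budget constraint satisfying $\lambda^\star\in[0,U_\lambda]$, where $$U_\lambda:=\rho^{\frac{1-p}{p}}\,G,\qquad G:=\max_{i\in[N]}G_i,\qquad G_i:=\max_{k\in[K]}\max\{\|\xi\|_*:\xi\in\partial\ell_k(\hat z_i)\}.$$
   Context: Notation: $[n]=\{1,\dots,n\}$; $\mathcal P(\mathcal Z)$ is the set of Borel probability measures on $\mathcal Z$; $\|\cdot\|_*$ is the dual norm of the norm $\|\cdot\|$ below; $\partial\ell_k(\hat z_i)$ is the superdifferential of the concave function $\ell_k$ at $\hat z_i$. An optimal dual multiplier is a minimizer over $\lambda\ge0$ of the Lagrangian dual function $\lambda\mapsto\lambda\rho+\frac1N\sum_{i=1}^N\sup_{b\ge0}\{V_i(b)-\lambda b\}$. Setting. $\mathcal X\subseteq\mathbb R^n$, $\mathcal Z\subseteq\mathbb R^m$. A transportation cost $c:\mathcal Z\times\mathcal Z\to\mathbb R_+$ is lower semicontinuous, satisfies $c(z,z)=0$ for all $z$, and $c(\cdot,\hat z)$ is convex for every fixed $\hat z\in\mathcal Z$. The optimal transport discrepancy is $\mathrm{OT}_c(\mathbb P,\mathbb Q)=\min_{\gamma}\mathbb E_{(z,\hat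 z)\sim\gamma}[c(z,\hat z)]$ over couplings $\gamma$ of $\mathbb P$ and $\mathbb Q$. Given $\hat z_1,\dots,\hat z_N\in\mathcal Z$, let $\hat{\mathbb P}=\frac1N\sum_{i=1}^N\delta_{\hat z_i}$; given $\rho>0$, let $\mathcal P=\{\mathbb P\in\mathcal P(\mathcal Z):\mathrm{OT}_c(\mathbb P,\hat{\mathbb P})\le\rho\}$. Regularity assumption. (i) $\mathcal X$ is nonempty and convex; there exist $\mathbb Q_0\in\mathcal P$ and $x_0\in\mathcal X$ such that $x\mapsto\mathbb E_{z\sim\mathbb Q_0}[\ell(x,z)]$ is inf-compact on $\mathcal X$ (all sublevel sets are compact) and $\mathbb E_{z\sim\mathbb Q_0}[\ell(x_0,z)]>-\infty$; $\mathcal Z$ is nonempty, closed and convex. (ii) $\ell(x,z)=\max_{k\in[K]}\ell_k(x,z)$ with $K\ge2$, where each $\ell_k:\mathbb R^n\times\mathbb R^m\to\mathbb R$ is real-valued, convex in its first and concave in its second argument. (iii) There exist a norm $\|\cdot\|$ on $\mathbb R^m$ and $p\ge1$ with $c(z,\hat z)\ge\|z-\hat z\|^p$ for all $z,\hat z\in\mathcal Z$; moreover, if $p=1$, then for every $x\in\mathcal X$ there exist $g>0$, $\hat z_0\in\mathcal Z$ and $r\in[0,1)$ such that $\ell(x,z)\le g[1+\|z-\hat z_0\|^r]$ for all $z\in\mathcal Z$. Local worst-case oracle assumption. For any $k\in[K]$, $\hat z\in\mathcal Z$, radius $u\ge0$ and accuracy $\epsilon>0$ there is an algorithm that returns $\hat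 v\in\mathbb R^m$ with $\hat z+\hat v\in\mathcal Z$, $c(\hat z+\hat v,\hat z)\le u$, together with $\hat L=\ell_k(\hat z+\hat v)\ge\max\{\ell_k(\hat z+v):v\in\mathbb R^m,\hat z+v\in\mathcal Z,c(\hat z+v,\hat z)\le u\}-\epsilon$. Local utilities. $V_i(b)=\max_{1\le k_1<k_2\le K}V_i^{(k_1,k_2)}(b)$, where $V_i^{(k_1,k_2)}(b)$ is the maximum of $\alpha_1\ell_{k_1}(\hat z_i+v_1)+\alpha_2\ell_{k_2}(\hat z_i+v_2)$ over $\alpha_j,\beta_j\in\mathbb R_+$, $v_j\in\mathbb R^m$ with $\hat z_i+v_j\in\mathcal Z$, $\alpha_jc(\hat z_i+v_j,\hat z_i)\le\beta_j$ ($j=1,2$), $\alpha_1+\alpha_2=1$, $\beta_1+\beta_2=b$. *)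

(* Defs.v *)
From mathcomp Require Import all_boot all_order all_algebra.
From mathcomp Require Import all_classical all_reals all_analysis.
Import Order.TTheory GRing.Theory Num.Theory numFieldNormedType.Exports.

Set Implicit Arguments.
Unset Strict Implicit.
Unset Printing Implicit Defensive.

Local Open Scope classical_set_scope.
Local Open Scope ring_scope.

(* 'rV[R]_m with its Borel sigma-algebra. *)
Definition borel_rV (R : realType) (m : nat) :=
  g_sigma_algebraType (@open 'rV[R]_m).

Section Vectors.
Context {R : realType}.

Definition dotp {m : nat} (u v : 'rV[R]_m) : R := \sum_(j < m) u 0 j * v 0 j.

Record is_norm {m : nat} (nm : 'rV[R]_m -> R) : Prop := IsNorm {
  is_norm_triangle : forall u v, nm (u + v) <= nm u + nm v;
  is_norm_homog : forall (a : R) v, nm (a *: v) = `|a| * nm v;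
  is_norm_def : forall v, nm v = 0 -> v = 0 }.

(* Suprema of real sets are used for maxima of nonempty compact sets. *)
Definition dual_norm {m : nat} (nm : 'rV[R]_m -> R) (xi : 'rV[R]_m) : R :=
  sup [set dotp xi v | v in [set v | nm v <= 1]].

Definition superdiff {m : nat} (f : 'rV[R]_m -> R) (zh : 'rV[R]_m) :
    set 'rV[R]_m :=
  [set xi | forall z, f z <= f zh + dotp xi (z - zh)].

End Vectors.

Section Transport.
Context {R : realType} {m : nat}.
Implicit Types (Z : set 'rV[R]_m) (c : 'rV[R]_m -> 'rV[R]_m -> R).

(* Only the restriction of c to Z x Z is relevant; semicontinuity is with
   respect to the relative topology of Z x Z. *)
Record transport_cost Z c : Prop := TransportCost {
  cost_ge0 : forall z zh, Z z -> Z zh -> 0 <= c z zh;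
  cost_lsc : @lower_semicontinuous (subspace (Z `*` Z)) R
               (fun w => (c w.1 w.2)%:E);
  cost_refl : forall z, Z z -> c z z = 0;
  cost_convex : forall zh, Z zh -> convex_function Z (c ^~ zh) }.

(* Measures on Z are represented by measures on the whole space giving full
   mass to Z, and are compared on Borel sets only. *)
Definition coupling (P Q : set (borel_rV R m) -> \bar R)
    (gamma : probability (borel_rV R m * borel_rV R m)%type R) : Prop :=
  forall B : set (borel_rV R m), measurable B ->
    gamma (B `*` setT) = P B /\ gamma (setT `*` B) = Q B.

Definition OT Z c (P Q : set (borel_rV R m) -> \bar R) : \bar R :=
  ereal_inf [set (\int[gamma]_(w in Z `*` Z) (c w.1 w.2)%:E)%E
            | gamma in coupling P Q].

Definition empirical {N : nat} (zh : 'I_N -> 'rV[R]_m)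
    (B : set (borel_rV R m)) : \bar R :=
  ((N%:R^-1)%:E * \sum_(i < N) \d_(zh i : borel_rV R m) B)%E.

Definition ambiguity_set Z c {N : nat} (zh : 'I_N -> 'rV[R]_m) (rho : R)
    (P : probability (borel_rV R m) R) : Prop :=
  P Z = 1%E /\ (OT Z c P (empirical zh) <= rho%:E)%E.

End Transport.

Section Loss.
Context {R : realType} {n m K : nat}.
Variable l : 'I_K -> 'rV[R]_n -> 'rV[R]_m -> R.

(* Extended-real-valued only because the maximum over 'I_K needs a bottom. *)
Definition loss (x : 'rV[R]_n) (z : 'rV[R]_m) : \bar R :=
  \big[maxe/-oo%E]_(k < K) (l k x z)%:E.

Definition expected_loss (Q : probability (borel_rV R m) R) (Z : set 'rV[R]_m)
    (x : 'rV[R]_n) : \bar R :=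
  (\int[Q]_(z in (Z : set (borel_rV R m))) loss x z)%E.

Definition inf_compact_on (X : set 'rV[R]_n) (f : 'rV[R]_n -> \bar R) : Prop :=
  forall a : R, compact [set x | X x /\ (f x <= a%:E)%E].

Record regularity (X : set 'rV[R]_n) (Z : set 'rV[R]_m)
    (c : 'rV[R]_m -> 'rV[R]_m -> R) (N : nat) (zh : 'I_N -> 'rV[R]_m) (rho : R)
    (nm : 'rV[R]_m -> R) (p : R) : Prop := Regularity {
  reg_X_nonempty : X !=set0;
  reg_X_convex : convex_set X;
  reg_inf_compact : exists Q0 x0,
    [/\ ambiguity_set Z c zh rho Q0, X x0,
        inf_compact_on X (expected_loss Q0 Z) &
        (-oo < expected_loss Q0 Z x0)%E];
  reg_Z_nonempty : Z !=set0;
  reg_Z_closed : closed Z;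
  reg_Z_convex : convex_set Z;
  reg_K : (2 <= K)%N;
  reg_l_convex : forall k z, convex_function setT (fun x => l k x z);
  reg_l_concave : forall k x, convex_function setT (fun z => - l k x z);
  reg_norm : is_norm nm;
  reg_p : 1 <= p;
  reg_cost_growth : forall z z', Z z -> Z z' -> nm (z - z') `^ p <= c z z';
  reg_loss_growth : p = 1 -> forall x, X x ->
    exists (g r : R) (z0 : 'rV[R]_m),
      [/\ 0 < g, 0 <= r < 1, Z z0 &
          forall z, Z z -> (loss x z <= (g * (1 + nm (z - z0) `^ r))%:E)%E] }.

End Loss.

Section Local.
Context {R : realType} {m K : nat}.
Variables (Z : set 'rV[R]_m) (c : 'rV[R]_m -> 'rV[R]_m -> R).
(* The components at a fixed decision x. *)
Variable l : 'I_K -> 'rV[R]_m -> R.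

Definition cost_ball (zh : 'rV[R]_m) (u : R) : set 'rV[R]_m :=
  [set v | Z (zh + v) /\ c (zh + v) zh <= u].

(* The pair (v, L) is the output of the algorithm on input (k, zh, u, eps). *)
Definition local_worst_case_oracle : Prop :=
  forall (k : 'I_K) (zh : 'rV[R]_m) (u eps : R), Z zh -> 0 <= u -> 0 < eps ->
  exists (v : 'rV[R]_m) (L : R),
    [/\ Z (zh + v), c (zh + v) zh <= u, L = l k (zh + v) &
        (ereal_sup [set (l k (zh + w))%:E | w in cost_ball zh u] - eps%:E
           <= L%:E)%E].

Definition local_utility2 (zh : 'rV[R]_m) (k1 k2 : 'I_K) (b : R) : \bar R :=
  ereal_sup [set y : \bar R |
    exists (a1 a2 b1 b2 : R) (v1 v2 : 'rV[R]_m),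
      [/\ [/\ 0 <= a1, 0 <= a2, 0 <= b1 & 0 <= b2],
          Z (zh + v1) /\ Z (zh + v2),
          a1 * c (zh + v1) zh <= b1 /\ a2 * c (zh + v2) zh <= b2,
          a1 + a2 = 1 /\ b1 + b2 = b &
          y = (a1 * l k1 (zh + v1) + a2 * l k2 (zh + v2))%:E]].

Definition local_utility (zh : 'rV[R]_m) (b : R) : \bar R :=
  \big[maxe/-oo%E]_(k1 < K) \big[maxe/-oo%E]_(k2 < K | (k1 < k2)%N)
    local_utility2 zh k1 k2 b.

(* Lagrangian dual of maximising (1/N) \sum_i V_i(b_i) over b >= 0 subject to
   (1/N) \sum_i b_i <= rho; it may take the value +oo. *)
Definition dual_function {N : nat} (zh : 'I_N -> 'rV[R]_m) (rho lambda : R) :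
    \bar R :=
  ((lambda * rho)%:E + (N%:R^-1)%:E * \sum_(i < N)
     ereal_sup [set (local_utility (zh i) b - (lambda * b)%:E)%E
               | b in [set b : R | (0 <= b)%R]])%E.

Definition optimal_dual_multiplier {N : nat} (zh : 'I_N -> 'rV[R]_m)
    (rho lambda : R) : Prop :=
  0 <= lambda /\ forall mu : R, 0 <= mu ->
    (dual_function zh rho lambda <= dual_function zh rho mu)%E.

(* The quantities maximised are norms, so 0 is a neutral default. *)
Definition slope_at (nm : 'rV[R]_m -> R) (zh : 'rV[R]_m) : R :=
  \big[Num.max/0]_(k < K) sup [set dual_norm nm xi | xi in superdiff (l k) zh].

Definition slope_max (nm : 'rV[R]_m -> R) {N : nat} (zh : 'I_N -> 'rV[R]_m) :
    R :=
  \big[Num.max/0]_(i < N) slope_at nm (zh i).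

Definition U_lambda (nm : 'rV[R]_m -> R) (p : R) {N : nat}
    (zh : 'I_N -> 'rV[R]_m) (rho : R) : R :=
  rho `^ ((1 - p) / p) * slope_max nm zh.

End Local.

(* Main.v *)
Require Import Defs.
From mathcomp Require Import all_boot all_order all_algebra.
From mathcomp Require Import all_classical all_reals all_analysis.
From mathcomp Require Import ring lra.
Import Order.TTheory GRing.Theory Num.Theory numFieldNormedType.Exports.

Local Open Scope classical_set_scope.
Local Open Scope ring_scope.

(* Restricting the dual function D to [0, U] loses nothing.  The budget 0
   gives D mu >= mu * rho + W, where W is the mean over i of max_k l_k(zh_i).
   A supergradient of l_k at zh_i gives l_k(zh_i + v) <= l_k(zh_i) + G * nm v,
   and with c >= nm ^ p and Bernoulli's inequality this yields
   D (U / p) <= W + U * rho.  Hence D mu >= D (U / p) as soon as mu > U, while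
   D, being lower semicontinuous, attains its minimum on [0, U]. *)

Lemma lte_EFin_dense (R : realType) (x y : \bar R) : (x < y)%E ->
  exists2 q : R, (x < q%:E)%E & (q%:E < y)%E.
Proof.
case: x y => [r| |] [s| |] //=.
- by rewrite lte_fin => rs; exists ((r + s) / 2); rewrite lte_fin; lra.
- by move=> _; exists (r + 1); rewrite ?ltry// lte_fin; lra.
- by move=> _; exists (s - 1); rewrite ?ltNyr// lte_fin; lra.
- by move=> _; exists 0; rewrite ?ltry ?ltNyr.
Qed.

Lemma lte_addr_split (R : realType) (a : R) (x y : \bar R) :
  (-oo < x)%E -> (-oo < y)%E -> (a%:E < x + y)%E ->
  exists a1 a2 : R, [/\ a1 + a2 = a, (a1%:E < x)%E & (a2%:E < y)%E].
Proof.
case: x y => [r| |] [s| |] //= _ _.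
- rewrite -EFinD !lte_fin => h; exists ((a + r - s) / 2), ((a + s - r) / 2).
  by rewrite !lte_fin; split; lra.
- by move=> _; exists (r - 1), (a - r + 1); rewrite lte_fin ltry; split => //; lra.
- by move=> _; exists (a - s + 1), (s - 1); rewrite lte_fin ltry; split => //; lra.
- by move=> _; exists a, 0; rewrite addr0 !ltry.
Qed.

Section Semicontinuity.
Context {R : realType} {T : topologicalType}.
Implicit Types f g : T -> \bar R.

Lemma lower_semicontinuous_cst (a : \bar R) :
  lower_semicontinuous (fun _ : T => a).
Proof. by move=> x b ab; exists setT => //; exact: filterT. Qed.

Lemma lower_semicontinuous_EFin (f : T -> R) :
  continuous f -> lower_semicontinuous (fun t => (f t)%:E).
Proof.
move=> cf x a; rewrite lte_fin => afx.
exists [set y | a < f y]; last by move=> y; rewrite lte_fin.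
exact: (cvgr_gt _ (cf x)).
Qed.

Lemma lower_semicontinuousD f g :
  (forall t, (-oo < f t)%E) -> (forall t, (-oo < g t)%E) ->
  lower_semicontinuous f -> lower_semicontinuous g ->
  lower_semicontinuous (fun t => f t + g t)%E.
Proof.
move=> fNy gNy lf lg x a /(lte_addr_split _ _ _ _ (fNy x) (gNy x)).
move=> [a1 [a2 [<- /lf[A xA fA] /lg[B xB gB]]]].
exists (A `&` B); first exact: filterI.
by move=> y [/fA ? /gB ?]; rewrite EFinD lteD.
Qed.

Lemma lower_semicontinuous_sum n (f : 'I_n -> T -> \bar R) :
  (forall i t, (-oo < f i t)%E) -> (forall i, lower_semicontinuous (f i)) ->
  lower_semicontinuous (fun t => \sum_(i < n) f i t)%E.
Proof.
elim: n f => [|n IH] f fNy lf.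
  rewrite [X in lower_semicontinuous X](_ : _ = fun=> 0%E); last first.
    by apply/funext => t; rewrite big_ord0.
  exact: lower_semicontinuous_cst.
rewrite [X in lower_semicontinuous X](_ : _ =
  fun t => (f ord0 t + \sum_(i < n) f (lift ord0 i) t)%E); last first.
  by apply/funext => t; rewrite big_ord_recl.
apply: lower_semicontinuousD => //; last by apply: IH => // i.
move=> t; rewrite ltNye; apply/negP => /eqP/esum_eqNyP[i [_ _ h]].
by have := fNy (lift ord0 i) t; rewrite h ltxx.
Qed.

Lemma lower_semicontinuousZ f (k : R) : 0 < k ->
  lower_semicontinuous f -> lower_semicontinuous (fun t => k%:E * f t)%E.
Proof.
move=> k0 lf x a.
have e y : (a%:E < k%:E * f y)%E = ((k^-1 * a)%:E < f y)%E.
  by rewrite EFinM lte_pdivrMl.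
by rewrite e => /lf[V xV h]; exists V => // y /h; rewrite e.
Qed.

Lemma lower_semicontinuous_sup I (D : set I) (f : I -> T -> \bar R) :
  (forall i, D i -> lower_semicontinuous (f i)) ->
  lower_semicontinuous (fun t => ereal_sup [set f i t | i in D]).
Proof.
move=> lf x a /ereal_sup_gt[_ [i Di <-]] /(lf i Di)[V xV h].
by exists V => // y /h /lt_le_trans; apply; apply: ereal_sup_ubound; exists i.
Qed.

Lemma compact_lower_semicontinuous_min f (A : set T) :
  A !=set0 -> compact A -> lower_semicontinuous f ->
  exists2 x, A x & forall y, A y -> (f x <= f y)%E.
Proof.
move=> [x0 Ax0] cA lf; pose M := ereal_inf [set f y | y in A].
have MP y : A y -> (M <= f y)%E by move=> Ay; apply: ereal_inf_lbound; exists y.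
have [My|Mfin] := eqVneq M +oo%E.
  exists x0 => // y /MP; rewrite My leye_eq => /eqP ->; exact: leey.
pose F := filter_from [set y | (M < y)%E] (fun y => [set x | A x /\ (f x < y)%E]).
have FF : ProperFilter F.
  apply: filter_from_proper.
    apply: filter_from_filter.
      by exists +oo%E; rewrite /= ltey.
    move=> i j /= Mi Mj; exists (mine i j); first by rewrite lt_min Mi.
    by move=> x [Ax]; rewrite lt_min => /andP[].
  move=> y /= /ereal_inf_lt[_ [x Ax <-] fxy]; by exists x.
have FA : F A by exists +oo%E => [|x []//]; rewrite /= ltey.
have [x [Ax clx]] := cA F FF FA.
exists x => // y /MP; apply: le_trans; rewrite leNgt; apply/negP => Mx.
have [q Mq qx] := lte_EFin_dense _ _ _ Mx.
have [V xV Vq] := lf _ _ qx.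
have Fq : F [set x | A x /\ (f x < q%:E)%E] by exists q%:E.
have [z [[_ zq] Vz]] := clx _ _ Fq xV.
by have := Vq z Vz; rewrite ltNge (ltW zq).
Qed.

End Semicontinuity.

Lemma powR_bernoulli (R : realType) (p s : R) :
  1 <= p -> 0 <= s -> 1 + p * (s - 1) <= s `^ p.
Proof.
move=> p1 s0; have p0 : 0 < p by lra.
have [h|h] := leP (1 + p * (s - 1)) 0; first exact: le_trans h (powR_ge0 _ _).
have sp : 0 < s.
  rewrite lt_neqAle s0 andbT; apply/eqP => e.
  by move: h; rewrite -e sub0r mulrN1; lra.
have ip1 : p^-1 <= 1 by rewrite invf_le1.
have ip0 : 0 <= p^-1 by rewrite invr_ge0 ltW.
have := concave_ln (Itv01 ip0 ip1) h (@ltr01 R).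
rewrite !convRE/= ln1 /unstable.onem (_ : _ + _ * 1 = s); last first.
  by rewrite mulrDr mulr1 mulKf ?gt_eqF// mulr1; lra.
rewrite (_ : _ + _ * 0 = p^-1 * ln (1 + p * (s - 1))); last by rewrite mulr0 addr0.
rewrite ler_pdivrMl// -ln_powR ler_ln// posrE ?powR_gt0//.
Qed.

Section Dotp.
Context {R : realType} {m : nat}.
Implicit Types u v w : 'rV[R]_m.

Lemma dotpDr u v w : dotp u (v + w) = dotp u v + dotp u w.
Proof. by rewrite /dotp -big_split; apply: eq_bigr => j _; rewrite mxE mulrDr. Qed.

Lemma dotpZr a u v : dotp u (a *: v) = a * dotp u v.
Proof. by rewrite /dotp mulr_sumr; apply: eq_bigr => j _; rewrite mxE mulrCA. Qed.

Lemma dotpC u v : dotp u v = dotp v u.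
Proof. by apply: eq_bigr => j _; rewrite mulrC. Qed.

Lemma dotp_delta u k : dotp u (delta_mx 0 k) = u 0 k.
Proof.
rewrite /dotp (bigD1 k)//= mxE !eqxx mulr1 big1 ?addr0// => j jk.
by rewrite mxE (negPf jk) andbF mulr0.
Qed.

End Dotp.

Definition concave {R : realType} {m : nat} (f : 'rV[R]_m -> R) :=
  forall (t : R) u v, 0 <= t <= 1 ->
    t * f u + (1 - t) * f v <= f (t *: u + (1 - t) *: v).

Section Concave.
Context {R : realType} {m : nat}.
Implicit Types (f : 'rV[R]_m -> R) (u v w z e : 'rV[R]_m).

Lemma convex_functionN_concave f :
  convex_function setT (fun z => - f z) -> concave f.
Proof.
move=> cf t u v /andP[t0 t1].
have := cf (Itv01 t0 t1) u v; rewrite !inE => /(_ I I).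
by rewrite convRE/= !mulrN -opprD lerN2.
Qed.

(* One Hahn-Banach step: extends the zero majorant of f from P along e. *)
Lemma concave_slope_ex f (P : set 'rV[R]_m) e : concave f ->
  P 0 ->
  (forall (t : R) u v, 0 <= t <= 1 -> P u -> P v -> P (t *: u + (1 - t) *: v)) ->
  (forall w, P w -> f w <= 0) ->
  exists a, forall w t, P w -> f (w + t *: e) <= a * t.
Proof.
move=> cf P0 Pc fP.
pose S := [set y | exists w t, [/\ P w, 0 < t & y = f (w + t *: e) / t]].
have Sub w' s : P w' -> 0 < s -> ubound S (- f (w' - s *: e) / s).
  move=> Pw' s0 _ [w [t [Pw t0 ->]]].
  rewrite ler_pdivrMr// mulrAC ler_pdivlMr// mulNr -subr_ge0.
  have st0 : 0 < s + t by lra.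
  have h01 : 0 <= s / (s + t) <= 1.
    by apply/andP; split; [rewrite divr_ge0// ltW | rewrite ler_pdivrMr//; lra].
  have := cf (s / (s + t)) (w + t *: e) (w' - s *: e) h01.
  have -> : 1 - s / (s + t) = t / (s + t) by field; rewrite gt_eqF.
  have -> : (s / (s + t)) *: (w + t *: e) + (t / (s + t)) *: (w' - s *: e)
     = (s / (s + t)) *: w + (1 - s / (s + t)) *: w'.
    have -> : 1 - s / (s + t) = t / (s + t) by field; rewrite gt_eqF.
    rewrite !scalerDr !scalerN !scalerA addrACA (mulrAC t) (mulrC t s).
    by rewrite (mulrAC s) subrr addr0.
  move=> /le_trans/(_ (fP _ (Pc _ _ _ h01 Pw Pw'))).
  rewrite !(mulrAC _ _^-1) -mulrDl pmulr_lle0 ?invr_gt0//; lra.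
have S0 : S !=set0 by exists (f (0 + 1 *: e) / 1), 0, 1.
have Sb : has_ubound S by exists (- f (0 - 1 *: e) / 1); exact: Sub.
exists (sup S) => w t Pw.
have [t0|t0|->] := ltgtP t 0.
- have := ge_sup S0 (Sub w (- t) Pw _); rewrite oppr_gt0 => /(_ t0).
  rewrite scaleNr opprK ler_pdivlMr ?oppr_gt0//; lra.
- by rewrite -ler_pdivrMr//; apply: ub_le_sup => //; exists w, t.
- by rewrite scale0r addr0 mulr0 fP.
Qed.

Lemma row_subdelta_eq0 (w : 'rV[R]_m) (k : 'I_m) :
  (forall j : 'I_m, (k < j)%N -> w 0 j = 0) ->
  forall j : 'I_m, (k <= j)%N -> (w - w 0 k *: delta_mx 0 k) 0 j = 0.
Proof.
move=> w0 j; rewrite leq_eqVlt => /orP[/eqP/val_inj <-|kj].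
  by rewrite !mxE !eqxx mulr1 subrr.
have jk : j != k by apply/eqP => e; rewrite e ltnn in kj.
by rewrite !mxE (w0 j)// (negPf jk) andbF mulr0 subr0.
Qed.

Lemma concave_superdiff_nonempty f z : concave f -> superdiff f z !=set0.
Proof.
move=> cf.
suff h k : (k <= m)%N -> exists xi : 'rV[R]_m, forall w,
    (forall j : 'I_m, (k <= j)%N -> w 0 j = 0) -> f (z + w) - f z - dotp xi w <= 0.
  have [xi hxi] := h m (leqnn m); exists xi => y.
  have /= := hxi (y - z); rewrite (addrC z) subrK => hy.
  suff : f y - f z - dotp xi (y - z) <= 0 by lra.
  by apply: hy => j; rewrite leqNgt ltn_ord.
elim: k => [_|k IH km].
  exists 0 => w w0; have -> : w = 0 by apply/rowP => j; rewrite w0// mxE.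
  rewrite addr0 subrr /dotp big1 ?subr0// => j _; by rewrite mxE mulr0.
have [xi hxi] := IH (ltnW km); pose e : 'rV[R]_m := delta_mx 0 (Ordinal km).
have := @concave_slope_ex (fun w => f (z + w) - f z - dotp xi w)
  [set w | forall j : 'I_m, (k <= j)%N -> w 0 j = 0] e.
case => //.
- move=> t u v t01; have := cf t (z + u) (z + v) t01.
  have -> : t *: (z + u) + (1 - t) *: (z + v) = z + (t *: u + (1 - t) *: v).
    by rewrite !scalerDr addrACA -scalerDl (addrC t) subrK scale1r.
  by rewrite dotpDr !dotpZr; lra.
- by move=> j _; rewrite mxE.
- by move=> t u v _ hu hv j kj; rewrite !mxE hu// hv// !mulr0 addr0.
move=> a ha; exists (xi + a *: e) => w hw.
pose t := w 0 (Ordinal km).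
have := ha (w - t *: e) t; rewrite subrK => /(_ _)/=.
have -> : dotp (xi + a *: e) w = dotp xi w + a * t.
  by rewrite dotpC dotpDr dotpZr dotp_delta dotpC.
by move=> /(_ (row_subdelta_eq0 _ (Ordinal km) hw)); lra.
Qed.

(* On a box, a concave function is bounded below by its values at the vertices. *)
Lemma concave_box_lbound f z (C : R) : concave f ->
  exists B, forall w, (forall j, `|w 0 j| <= C) -> B <= f (z + w).
Proof.
move=> cf.
suff h k : (k <= m)%N -> forall z, exists B, forall w : 'rV[R]_m,
    (forall j, `|w 0 j| <= C) ->
    (forall j : 'I_m, (k <= j)%N -> w 0 j = 0) -> B <= f (z + w).
  have [B hB] := h m (leqnn m) z; exists B => w hw; apply: hB => // j.
  by rewrite leqNgt ltn_ord.
elim: k => [_ {}z|k IH km {}z].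
  exists (f z) => w _ w0; have -> : w = 0 by apply/rowP => j; rewrite w0// mxE.
  by rewrite addr0.
pose e : 'rV[R]_m := delta_mx 0 (Ordinal km).
have [B1 h1] := IH (ltnW km) (z + C *: e).
have [B2 h2] := IH (ltnW km) (z - C *: e).
exists (Num.min B1 B2) => w wC w0.
pose t := w 0 (Ordinal km).
have := wC (Ordinal km); rewrite -/t ler_norml => /andP[tC1 tC2].
have we0 := row_subdelta_eq0 _ (Ordinal km) w0.
have weC j : `|(w - t *: e) 0 j| <= C.
  have [jk|kj] := eqVneq j (Ordinal km).
    by rewrite we0 ?jk//= normr0 (le_trans _ (wC j)).
  by rewrite !mxE (negPf kj) andbF mulr0 subr0.
have := h1 _ weC we0; have := h2 _ weC we0.
set u2 := _ + _; set u1 := z + _ + _ => H2 H1.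
have [th th01 thC] : exists2 th, 0 <= th <= 1 & t = th * C - (1 - th) * C.
  have [C0|C0] := eqVneq C 0.
    exists 0; [by lra|]; rewrite C0; move: tC1 tC2; rewrite C0; lra.
  have Cp : 0 < C by rewrite lt_neqAle eq_sym C0; lra.
  exists ((t + C) / (2 * C)); last by field.
  by apply/andP; split; [rewrite divr_ge0 | rewrite ler_pdivrMr]; lra.
have -> : z + w = th *: u1 + (1 - th) *: u2.
  by apply/rowP => j; rewrite !mxE thC; ring.
apply: le_trans (cf _ _ _ th01).
have : Num.min B1 B2 <= f u1 by rewrite ge_min H1.
have : Num.min B1 B2 <= f u2 by rewrite ge_min H2 orbT.
by move: (Num.min _ _) => B; nra.
Qed.

End Concave.

Section Norm.
Context {R : realType} {m : nat}.
Variables (nm : 'rV[R]_m -> R) (hnm : is_norm nm).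
Implicit Types (u v : 'rV[R]_m) (f : 'rV[R]_m -> R).

Lemma is_norm0 : nm 0 = 0.
Proof. by rewrite -(scale0r 0) is_norm_homog// normr0 mul0r. Qed.

Lemma is_normN v : nm (- v) = nm v.
Proof. by rewrite -scaleN1r is_norm_homog// normrN1 mul1r. Qed.

Lemma is_norm_ge0 v : 0 <= nm v.
Proof.
have := is_norm_triangle hnm v (- v).
by rewrite subrr is_norm0 is_normN; lra.
Qed.

Lemma row_coord_le_norm v j : `|v 0 j| <= `|v|.
Proof.
rewrite [leRHS]/Num.norm/= mx_normrE.
exact: (le_bigmax _ (fun ij : 'I_1 * 'I_m => `|v ij.1 ij.2|) (0, j)).
Qed.

Lemma is_norm_le_mx_norm : exists2 C, 0 < C & forall v, nm v <= C * `|v|.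
Proof.
exists (1 + \sum_j nm (delta_mx 0 j)).
  by rewrite ltr_pwDl// sumr_ge0// => j _; exact: is_norm_ge0.
move=> v; rewrite {1}(row_sum_delta v).
have le_sum (s : seq 'I_m) : nm (\sum_(j <- s) v 0 j *: delta_mx 0 j) <=
    \sum_(j <- s) `|v 0 j| * nm (delta_mx 0 j).
  elim: s => [|j s IH]; first by rewrite !big_nil is_norm0.
  rewrite !big_cons (le_trans (is_norm_triangle hnm _ _))//.
  by rewrite is_norm_homog// lerD2l.
apply: le_trans (le_sum _) _.
rewrite mulrDl mul1r -[leLHS]add0r lerD// mulr_suml ler_sum// => j _.
by rewrite mulrC ler_wpM2l ?is_norm_ge0 ?row_coord_le_norm.
Qed.

Lemma is_norm_continuous : continuous nm.
Proof.
have [C C0 hC] := is_norm_le_mx_norm.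
move=> v; apply/(@cvgrPdist_lt _ _ _ (nbhs v) (nbhs_filter v) nm (nm v)) => e e0.
near=> u.
have h : nm (v - u) < e.
  apply: le_lt_trans (hC _) _; rewrite mulrC -ltr_pdivlMr//.
  by near: u; apply: (@cvgr_dist_lt _ _ _ (nbhs v) (nbhs_filter v) id v) => //; exact: divr_gt0.
have h1 := is_norm_triangle hnm (v - u) u.
have h2 := is_norm_triangle hnm (u - v) v.
rewrite !subrK in h1 h2; rewrite -(opprB v u) is_normN in h2.
by rewrite ltr_norml; apply/andP; split; lra.
Unshelve. all: by end_near. Qed.

Lemma mx_norm_le_is_norm : exists2 d, 0 < d & forall v, d * `|v| <= nm v.
Proof.
pose S := [set v : 'rV[R]_m | `|v| = 1].
have Snorm v : v != 0 -> S (`|v|^-1 *: v).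
  by move=> v0; rewrite /S/= normrZ normfV normr_id mulVf// normr_eq0.
have [S0|S0] := pselect (S !=set0); last first.
  exists 1 => // v; have [->|v0] := eqVneq v 0.
    by rewrite normr0 mulr0 is_norm0.
  by case: S0; exists (`|v|^-1 *: v); exact: Snorm.
have cS : compact S.
  apply: bounded_closed_compact.
    by exists 1; split=> // M M1 v /= ->; exact: ltW.
  apply: (@preimage_closed _ _ (@Num.norm _ 'rV[R]_m) [set x | x = 1]).
    by move=> v _; exact: norm_continuous.
  exact: closed_eq.
have [v0 v0S hv0] := EVT_min_rV S0 cS (continuous_subspaceT is_norm_continuous).
rewrite inE /S/= in v0S.
have v00 : 0 < nm v0.
  rewrite lt_neqAle is_norm_ge0 andbT; apply/eqP => /esym/(is_norm_def hnm) e.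
  by move: v0S; rewrite e normr0; lra.
exists (nm v0) => // v; have [->|vn0] := eqVneq v 0.
  by rewrite normr0 mulr0 is_norm0.
have := hv0 (`|v|^-1 *: v); rewrite inE => /(_ (Snorm _ vn0)).
by rewrite is_norm_homog// normfV normr_id ler_pdivlMl ?normr_gt0// mulrC.
Qed.

Lemma dotp_le_dual_norm xi v M : (forall u, nm u <= 1 -> dotp xi u <= M) ->
  dotp xi v <= dual_norm nm xi * nm v.
Proof.
move=> hM; have [v0|v0] := eqVneq (nm v) 0.
  by rewrite v0 (is_norm_def hnm v0) mulr0 -(scale0r 0) dotpZr mul0r.
have vp : 0 < nm v by rewrite lt_neqAle eq_sym v0 is_norm_ge0.
rewrite -ler_pdivrMr// mulrC -dotpZr; apply: ub_le_sup.
  by exists M => _ [u /= hu <-]; exact: hM.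
exists ((nm v)^-1 *: v) => //=.
by rewrite is_norm_homog// normfV gtr0_norm// mulVf.
Qed.

Lemma concave_le_slope f z v : concave f ->
  f (z + v) <= f z + sup [set dual_norm nm xi | xi in superdiff f z] * nm v.
Proof.
move=> cf; have [d d0 hd] := mx_norm_le_is_norm.
have [B hB] := concave_box_lbound f z d^-1 cf.
have hM xi : superdiff f z xi -> forall u, nm u <= 1 -> dotp xi u <= f z - B.
  move=> hxi u u1; have := hxi (z - u).
  rewrite (addrAC z) subrr add0r -scaleN1r dotpZr mulN1r scaleN1r.
  suff : B <= f (z - u) by lra.
  apply: hB => j; rewrite (le_trans (row_coord_le_norm _ _))// normrN.
  by rewrite -[leRHS]mulr1 ler_pdivlMl// (le_trans (hd u)).
have [xi hxi] := concave_superdiff_nonempty f z cf.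
apply: (@le_trans _ _ (f z + dual_norm nm xi * nm v)).
  apply: le_trans (hxi _) _; rewrite (addrAC z) subrr add0r lerD2l.
  exact: dotp_le_dual_norm (hM _ hxi).
rewrite lerD2l ler_wpM2r ?is_norm_ge0//; apply: ub_le_sup; last by exists xi.
exists (f z - B) => _ [eta heta <-].
apply: ge_sup => [|_ [u /= u1 <-]]; last exact: (hM _ heta).
by exists (dotp eta 0), 0 => //=; rewrite is_norm0.
Qed.

End Norm.

Section Utilities.
Context {R : realType} {m K : nat}.
Variables (Z : set 'rV[R]_m) (c : 'rV[R]_m -> 'rV[R]_m -> R).
Variable l : 'I_K -> 'rV[R]_m -> R.
Implicit Types (z : 'rV[R]_m) (b lambda : R).

Lemma le_local_utility20 z (k1 k2 : 'I_K) (t : R) : Z z -> c z z = 0 ->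
  0 <= t <= 1 ->
  ((t * l k1 z + (1 - t) * l k2 z)%:E <= local_utility2 Z c l z k1 k2 0)%E.
Proof.
move=> Zz czz /andP[t0 t1]; apply: ereal_sup_ubound.
exists t, (1 - t), 0, 0, 0, 0; rewrite !addr0 czz !mulr0; split=> //; last first.
  by rewrite subrKC.
by rewrite subr_ge0.
Qed.

Lemma le_local_utility0 z (k : 'I_K) : (2 <= K)%N -> Z z -> c z z = 0 ->
  ((l k z)%:E <= local_utility Z c l z 0)%E.
Proof.
move=> K2 Zz czz.
have le_pair (k1 k2 : 'I_K) : (k1 < k2)%N ->
    (local_utility2 Z c l z k1 k2 0 <= local_utility Z c l z 0)%E.
  move=> k12; apply: le_trans (le_bigmax _ _ k1).
  exact: (le_bigmax_cond _ (fun k2 => local_utility2 Z c l z k1 k2 0)).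
have [k0|k0] := posnP k.
  have kk : (k < Ordinal K2)%N by rewrite k0.
  apply: le_trans (le_pair _ _ kk).
  have := @le_local_utility20 z k (Ordinal K2) 1 Zz czz.
  by rewrite ler01 lexx mul1r subrr mul0r addr0; exact.
have kk : (Ordinal (ltnW K2) < k)%N by [].
apply: le_trans (le_pair _ _ kk).
have := @le_local_utility20 z (Ordinal (ltnW K2)) k 0 Zz czz.
by rewrite ler01 lexx mul0r subr0 mul1r add0r; exact.
Qed.

Lemma local_utility_le z b lambda M : 0 <= lambda ->
  (forall k v, Z (z + v) -> l k (z + v) - lambda * c (z + v) z <= M) ->
  (local_utility Z c l z b - (lambda * b)%:E <= M%:E)%E.
Proof.
move=> lambda0 hM; rewrite leeBlDr//.
apply/bigmax_leP; split=> [|k1 _]; first exact: leNye.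
apply/bigmax_leP; split=> [|k2 _]; first exact: leNye.
apply: ge_ereal_sup => y [a1 [a2 [b1 [b2 [v1 [v2]]]]]].
move=> [[a10 a20 _ _] [Zv1 Zv2] [cb1 cb2] [a12 <-] ->].
rewrite -EFinD lee_fin.
have h1 := ler_wpM2l a10 (hM k1 v1 Zv1).
have h2 := ler_wpM2l a20 (hM k2 v2 Zv2).
have h3 := ler_wpM2l lambda0 cb1.
have h4 := ler_wpM2l lambda0 cb2.
have -> : M = a1 * M + a2 * M by rewrite -mulrDl a12 mul1r.
by lra.
Qed.

Definition utility_conjugate z lambda : \bar R :=
  ereal_sup [set (local_utility Z c l z b - (lambda * b)%:E)%E
            | b in [set b : R | 0 <= b]].

Lemma lower_semicontinuous_utility_conjugate z :
  lower_semicontinuous (utility_conjugate z).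
Proof.
apply: lower_semicontinuous_sup => b _.
case: (local_utility Z c l z b) => [r| |] /=; try exact: lower_semicontinuous_cst.
apply: (@lower_semicontinuous_EFin _ _ (fun lambda : R => r - lambda * b)).
by move=> x; apply: cvgB; [exact: cvg_cst|apply: cvgMl; exact: cvg_id].
Qed.

Lemma le_utility_conjugate z lambda (k : 'I_K) :
  (2 <= K)%N -> Z z -> c z z = 0 ->
  ((l k z)%:E <= utility_conjugate z lambda)%E.
Proof.
move=> K2 Zz czz; apply: le_trans (le_local_utility0 _ k K2 Zz czz) _.
by apply: ereal_sup_ubound; exists 0 => //=; rewrite mulr0 sube0.
Qed.

Lemma utility_conjugate_le z lambda M : 0 <= lambda ->
  (forall k v, Z (z + v) -> l k (z + v) - lambda * c (z + v) z <= M) ->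
  (utility_conjugate z lambda <= M%:E)%E.
Proof.
by move=> lambda0 hM; apply: ge_ereal_sup => _ [b _ <-]; exact: local_utility_le.
Qed.

End Utilities.

(* The multiplier [rho `^ ((1 - p) / p) * G / p] is the one for which the left
   side is maximal at [t = rho `^ p^-1], where equality holds. *)
Lemma linear_growth_conjugate (R : realType) (p rho G t : R) :
  1 <= p -> 0 < rho -> 0 <= G -> 0 <= t ->
  G * t - rho `^ ((1 - p) / p) * G / p * t `^ p <=
  (rho `^ ((1 - p) / p) * G - rho `^ ((1 - p) / p) * G / p) * rho.
Proof.
move=> p1 rho0 G0 t0; have p0 : 0 < p by lra.
set q := rho `^ p^-1; have q0 : 0 < q by exact: powR_gt0.
have qp : q `^ p = rho by rewrite /q -powRrM mulVf ?gt_eqF// powRr1// ltW.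
have -> : rho `^ ((1 - p) / p) = q / rho.
  rewrite mulrBl mul1r mulfV ?gt_eqF// powRB ?powRr1 1?ltW//.
  by rewrite (gt_eqF rho0) implybT.
have ts : t = (t / q) * q by rewrite mulfVK// gt_eqF.
have s0 : 0 <= t / q by rewrite divr_ge0// ltW.
have h := powR_bernoulli _ _ _ p1 s0.
move: (t / q) ts s0 h => s -> s0 h; rewrite powRM ?(ltW q0)// qp.
have -> : q / rho * G / p * (s `^ p * rho) = G * q / p * s `^ p.
  by field; rewrite !gt_eqF.
have -> : (q / rho * G - q / rho * G / p) * rho = G * q - G * q / p.
  by field; rewrite !gt_eqF.
have Gq0 : 0 <= G * q / p by rewrite !mulr_ge0// ?invr_ge0 ltW.
have := ler_wpM2l Gq0 h.
have -> : G * q / p * (1 + p * (s - 1)) = G * q / p + G * q * (s - 1).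
  by field; rewrite gt_eqF.
by lra.
Qed.

Theorem lemma13 (R : realType) (n m K N : nat)
  (X : set 'rV[R]_n) (Z : set 'rV[R]_m)
  (c : 'rV[R]_m -> 'rV[R]_m -> R)
  (l : 'I_K -> 'rV[R]_n -> 'rV[R]_m -> R)
  (zh : 'I_N -> 'rV[R]_m) (rho : R)
  (nm : 'rV[R]_m -> R) (p : R) (x : 'rV[R]_n)
  (hc : transport_cost Z c)
  (hN : (0 < N)%N) (hzh : forall i, Z (zh i)) (hrho : 0 < rho)
  (hreg : regularity l X Z c zh rho nm p)
  (hx : X x)
  (horacle : local_worst_case_oracle Z c (fun k => l k x)) :
  exists lambda : R,
    optimal_dual_multiplier Z c (fun k => l k x) zh rho lambda /\
    0 <= lambda <= U_lambda (fun k => l k x) nm p zh rho.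
Proof.
have hnm := reg_norm hreg; have p1 := reg_p hreg; have K2 := reg_K hreg.
have p0 : 0 < p by lra.
have czz i : c (zh i) (zh i) = 0 by apply: (cost_refl hc).
set f := fun k => l k x; set U := U_lambda f nm p zh rho.
set G := slope_max f nm zh.
have G0 : 0 <= G by apply/bigmax_geP; left.
have U0 : 0 <= U by rewrite mulr_ge0// powR_ge0.
have growth i k v : f k (zh i + v) <= f k (zh i) + G * nm v.
  have cf : concave (f k) by apply/convex_functionN_concave/(reg_l_concave hreg).
  apply: le_trans (concave_le_slope _ hnm _ (zh i) v cf) _.
  rewrite lerD2l ler_wpM2r ?is_norm_ge0//.
  apply: le_trans (le_bigmax _ (slope_at f nm \o zh) i).
  exact: (le_bigmax _
    (fun k => sup [set dual_norm nm xi | xi in superdiff (f k) (zh i)])).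
pose k0 : 'I_K := Ordinal (ltnW K2).
pose top i := [arg max_(k > k0) f k (zh i)]%O.
have topP i k : f k (zh i) <= f (top i) (zh i).
  by rewrite /top; case: arg_maxP => // j _; exact.
pose w i := f (top i) (zh i); pose W := N%:R^-1 * \sum_(i < N) w i.
pose phi i := utility_conjugate Z c f (zh i).
have DE lambda : dual_function Z c f zh rho lambda =
  ((lambda * rho)%:E + N%:R^-1%:E * \sum_(i < N) phi i lambda)%E by [].
have N0 : 0 < N%:R^-1 :> R by rewrite invr_gt0 ltr0n.
have w_le i lambda : ((w i)%:E <= phi i lambda)%E.
  exact: le_utility_conjugate.
have D_ge lambda : ((lambda * rho + W)%:E <= dual_function Z c f zh rho lambda)%E.
  rewrite DE EFinD leeD2l// EFinM lee_pmul2l// -sumEFin.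
  by apply: lee_sum => i _.
have D_le : (dual_function Z c f zh rho (U / p) <= (U * rho + W)%:E)%E.
  pose gap := (U - U / p) * rho.
  have phi_le i : (phi i (U / p)%R <= (w i + gap)%:E)%E.
    apply: utility_conjugate_le => [|k v Zv]; first by rewrite divr_ge0// ltW.
    have := reg_cost_growth hreg Zv (hzh i); rewrite (addrAC (zh i)) subrr add0r.
    move=> /(ler_wpM2l (divr_ge0 U0 (ltW p0))).
    have := linear_growth_conjugate _ _ _ _ _ p1 hrho G0 (is_norm_ge0 _ hnm v).
    rewrite -/G -/(U_lambda f nm p zh rho) -/U -/gap.
    by have := growth i k v; have := topP i k; rewrite -/(w i); lra.
  have -> : U * rho + W = U / p * rho + N%:R^-1 * \sum_(i < N) (w i + gap).
    rewrite big_split/= sumr_const card_ord -[gap *+ N]mulr_natl mulrDr mulKf.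
      by rewrite /gap -/W; ring.
    by rewrite pnatr_eq0 -lt0n.
  rewrite DE EFinD leeD2l// EFinM lee_pmul2l// -sumEFin.
  by apply: lee_sum => i _.
have phiNy i lambda : (-oo < phi i lambda)%E.
  exact: lt_le_trans (ltNyr _) (w_le i lambda).
have D_lsc : lower_semicontinuous (dual_function Z c f zh rho).
  apply: lower_semicontinuousD.
  - by move=> lambda; exact: ltNyr.
  - move=> lambda; apply: lt_le_trans (ltNyr W) _.
    by rewrite EFinM lee_pmul2l// -sumEFin; apply: lee_sum => i _; exact: w_le.
  - apply: (@lower_semicontinuous_EFin _ _ (fun lambda : R => lambda * rho)).
    by move=> y; apply: cvgMl; exact: cvg_id.
  - apply: lower_semicontinuousZ => //.
    apply: lower_semicontinuous_sum => // i.
    exact: lower_semicontinuous_utility_conjugate.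
have I0 : `[0, U]%classic !=set0 by exists 0; rewrite /= in_itv/= lexx.
have [lambda lambdaU min_lambda] :=
  compact_lower_semicontinuous_min _ _ I0 (@segment_compact _ 0 U) D_lsc.
rewrite /= in_itv/= in lambdaU; exists lambda; split=> //.
split=> [|mu mu0]; first by case/andP: lambdaU.
have [muU|Umu] := leP mu U; first by apply: min_lambda; rewrite /= in_itv/= mu0.
apply: le_trans (D_ge mu); apply: (@le_trans _ _ (U * rho + W)%:E).
  apply: le_trans D_le; apply: min_lambda; rewrite /= in_itv/= divr_ge0 ?(ltW p0)//=.
  by rewrite ler_pdivrMr// ler_peMr.
by rewrite lee_fin lerD2r ler_wpM2r// ltW.
Qed.
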